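(* Let $q\ge 1$ be an integer and let $S^{q-1}=\{(x_1,\dots,x_q)\in[0,1]^q : \sum_{i=1}^q x_i=1\}$. Consider the first-order Scheffé model $y=\sum_{i=1}^q\beta_i x_i+\varepsilon$ on the design region $S^{q-1}$, i.e. the linear regression model with regression function $\mathbf f(\mathbf x)=(x_1,\dots,x_q)^{\mathrm T}$. Then the $K$-optimal design for this model is the design supported on the $q$ vertices $e_1,\dots,e_q$ of $S^{q-1}$ (the standard basis vectors of $\mathbb R^q$) with weight vector $\mathbf w^*=(\tfrac1q,\dots,\tfrac1q)$. That is, this design minimizes the condition number $\lambda_{\max}(\mathbf M)/\lambda_{\min}(\mathbf M)$ of the information matrix over all approximate designs on $S^{q-1}$ with nonsingular information matrix.
   Context: An approximate design $\xi$ on a design region $\mathcal X\subset\mathbb R^q$ is a probability measure with finite support in $\mathcal X$, given by support points $\mathbf x_1,\dots,\mathbf x_n\in\mathcal X$ and weights $\omega_1,\dots,\omega_n>0$ with $\sum_{i=1}^n\omega_i=1$. For a linear regression model $y=\mathbf f^{\mathrm T}(\mathbf x)\theta+\varepsilon$ with regression function $\mathbf f:\mathcal X\to\mathbb R^p$, the information matrix of $\xi$ is the $p\times p$ symmetric positive semidefinite matrix $\mathbf M=\sum_{i=1}^n\omega_i\,\mathbf f(\mathbf x_i)\mathbf f^{\mathrm T}(\mathbf x_i)$. Its condition number is $\kappa(\mathbf M)=\lambda_{\max}(\mathbf M)/\lambda_{\min}(\mathbf M)$ if $\mathbf M$ is nonsingular (largest over smallest eigenvalue) and $\kappa(\mathbf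 M)=\infty$ if $\mathbf M$ is singular. A design is $K$-optimal if it minimizes $\kappa(\mathbf M)$ over the set of all approximate designs on $\mathcal X$ with nonsingular information matrix. *)

(* Defs.v *)
From mathcomp Require Import all_boot all_order all_algebra.
From mathcomp Require Import boolp classical_sets reals constructive_ereal.

Set Implicit Arguments.
Unset Strict Implicit.
Unset Printing Implicit Defensive.

Import Order.TTheory GRing.Theory Num.Theory.
Local Open Scope classical_set_scope.
Local Open Scope ring_scope.

Section Designs.
Context {R : realType}.

Definition spectrum p (M : 'M[R]_p) : set R := [set a | eigenvalue M a].

(* A symmetric matrix of positive size has a finite nonempty real spectrum,
   so these are its largest and smallest eigenvalues. *)
Definition lambda_max p (M : 'M[R]_p) : R := sup (spectrum M).
Definition lambda_min p (M : 'M[R]_p) : R := inf (spectrum M).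

Definition cond_number p (M : 'M[R]_p) : \bar R :=
  if M \in unitmx then (lambda_max M / lambda_min M)%:E else +oo%E.

(* The points x i are the distinct support points, the w i their weights. *)
Definition approx_design q (X : set 'cV[R]_q)
    n (x : 'I_n -> 'cV[R]_q) (w : 'I_n -> R) : Prop :=
  [/\ injective x,
      forall i, X (x i),
      forall i, 0 < w i
    & \sum_(i < n) w i = 1].

Definition info_matrix q p (f : 'cV[R]_q -> 'cV[R]_p)
    n (x : 'I_n -> 'cV[R]_q) (w : 'I_n -> R) : 'M[R]_p :=
  \sum_(i < n) w i *: (f (x i) *m (f (x i))^T).

Definition K_optimal q p (X : set 'cV[R]_q) (f : 'cV[R]_q -> 'cV[R]_p)
    n (x : 'I_n -> 'cV[R]_q) (w : 'I_n -> R) : Prop :=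
  [/\ approx_design X x w,
      info_matrix f x w \in unitmx
    & forall m (y : 'I_m -> 'cV[R]_q) (v : 'I_m -> R),
        approx_design X y v -> info_matrix f y v \in unitmx ->
        (cond_number (info_matrix f x w)
           <= cond_number (info_matrix f y v))%E].

Definition simplex q : set 'cV[R]_q :=
  [set x | (forall i, 0 <= x i ord0 <= 1) /\ \sum_(i < q) x i ord0 = 1].

Definition scheffe1 q (x : 'cV[R]_q) : 'cV[R]_q := \col_i x i ord0.

Definition vertex q (i : 'I_q) : 'cV[R]_q := delta_mx i ord0.

End Designs.

Arguments simplex R q : clear implicits.
Arguments vertex R q i : clear implicits.

(* Main.v *)
Require Import Defs.
From mathcomp Require Import all_boot all_order all_algebra.
From mathcomp Require Import boolp classical_sets reals constructive_ereal.
From mathcomp Require Import complex.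

Set Implicit Arguments.
Unset Strict Implicit.
Unset Printing Implicit Defensive.

Import Order.TTheory GRing.Theory Num.Theory.
Local Open Scope ring_scope.

(* The condition number of any nonsingular information matrix is at least 1,
   because such a matrix is symmetric positive definite. The uniform design on
   the vertices has information matrix (1/q) I, whose condition number is 1. *)

Lemma mulmx_tr_ge0 (R : realDomainType) n (v : 'rV[R]_n) :
  0 <= (v *m v^T) ord0 ord0.
Proof. by rewrite mxE sumr_ge0 // => i _; rewrite mxE -expr2 sqr_ge0. Qed.

(** The product is the sum of the squared moduli of the entries; without the conjugate it could
    vanish for a nonzero complex [v]. *)
Lemma mulmx_conj_tr_eq0 (C : numClosedFieldType) n (v : 'rV[C]_n) :
  (v *m (map_mx Num.conj v)^T == 0) = (v == 0).
Proof.
apply/eqP/eqP => [vv0|->]; last by rewrite mul0mx.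
move/matrixP/(_ ord0 ord0): vv0; rewrite !mxE.
under eq_bigr => i _ do rewrite !mxE -normCK.
move/eqP; rewrite psumr_eq0 => [/allP h|i _]; last exact: exprn_ge0.
apply/rowP => i; rewrite mxE; apply/eqP.
by have := h i (mem_index_enum _); rewrite /= sqrf_eq0 normr_eq0.
Qed.

Lemma real_symmetric_eigenvalue_real (R : rcfType) n (M : 'M[R]_n) (z : R[i]) :
  M^T = M -> eigenvalue (map_mx (real_complex R) M) z -> z \is Num.real.
Proof.
move=> symM /eigenvalueP[v vM v0]; set Mc := map_mx _ M in vM.
pose w := map_mx Num.conj v.
have McJ : map_mx Num.conj Mc = Mc.
  by apply/matrixP => i j; rewrite !mxE; apply: conj_Creal; rewrite complex_real.
have wM : w *m Mc = Num.conj z *: w.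
  by rewrite -{1}McJ -map_mxM vM map_mxZ.
have McT : Mc^T = Mc by rewrite /Mc map_trmx symM.
(* Both sides equal [v *m Mc *m w^T]: [Mc] acts on [v], or, by symmetry, on [w]. *)
have : z *: (v *m w^T) = Num.conj z *: (v *m w^T).
  by rewrite scalemxAl -vM -[in LHS]McT -mulmxA -trmx_mul wM linearZ -scalemxAr.
move/eqP; rewrite -subr_eq0 -scalerBl scaler_eq0 mulmx_conj_tr_eq0 (negPf v0).
by rewrite orbF subr_eq0 eq_sym CrealE.
Qed.

Lemma eigenvalue_map_mx (F K : fieldType) (f : {rmorphism F -> K})
    n (M : 'M[F]_n) (a : F) :
  eigenvalue (map_mx f M) (f a) = eigenvalue M a.
Proof. by rewrite !eigenvalue_root_char -map_char_poly fmorph_root. Qed.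

(** The characteristic polynomial has a root in [R[i]], and symmetry makes it real. This makes the
    spectrum nonempty, so that its [sup] and [inf] are meaningful. *)
Lemma symmetric_eigenvalue_exists (R : rcfType) n (M : 'M[R]_n) :
  (0 < n)%N -> M^T = M -> exists a, eigenvalue M a.
Proof.
move=> n0 symM; set Mc := map_mx (real_complex R) M.
have /closed_rootP[z] : size (char_poly Mc) != 1.
  by rewrite size_char_poly eqSS -lt0n.
rewrite -eigenvalue_root_char => zM.
exists (complex.Re z); rewrite -(eigenvalue_map_mx (real_complex R)).
by rewrite /= RRe_real // (real_symmetric_eigenvalue_real symM).
Qed.

(** The list holds the real parts of all complex roots of the characteristic polynomial, so it may
    also contain numbers that are not eigenvalues. *)
Lemma eigenvalues_finite (R : rcfType) n (M : 'M[R]_n) :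
  exists s : seq R, forall a, eigenvalue M a -> a \in s.
Proof.
set p := char_poly (map_mx (real_complex R) M).
have [rs defp] := closed_field_poly_normal p.
exists (map (@complex.Re R) rs) => a.
rewrite -(eigenvalue_map_mx (real_complex R)) eigenvalue_root_char -/p defp.
rewrite (monicP (char_poly_monic _)) scale1r root_prod_XsubC => ars.
by apply/mapP; exists a%:C%C.
Qed.

Lemma unitmx_eigenvalue_neq0 (F : fieldType) n (M : 'M[F]_n) (a : F) :
  M \in unitmx -> eigenvalue M a -> a != 0.
Proof.
move=> uM /eigenvalueP[v vM]; apply: contra_neq => a0.
by rewrite -(mulmxK uM v) vM a0 scale0r mul0mx.
Qed.

Lemma cond_number_ge1 (R : realType) n (M : 'M[R]_n) :
  (0 < n)%N -> M^T = M -> (forall v : 'rV_n, 0 <= (v *m M *m v^T) ord0 ord0) ->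
  (1%:E <= cond_number M)%E.
Proof.
move=> n0 symM psdM; rewrite /cond_number; case: ifPn => [uM|_]; last exact: leey.
have [a aM] := symmetric_eigenvalue_exists n0 symM.
have [s sM] := eigenvalues_finite M.
have pos b : eigenvalue M b -> 0 < b.
  (* Nonsingularity excludes [b = 0]; for an eigenvector [v], the form at [v] is [b] times the
     positive number [v *m v^T], so [b] is nonnegative. *)
  move=> bM; rewrite lt0r (unitmx_eigenvalue_neq0 uM bM).
  case/eigenvalueP: bM => v vM v0; have := psdM v.
  rewrite vM -scalemxAl mxE pmulr_lge0 // lt0r mulmx_tr_ge0 andbT.
  apply: contra_neq v0 => /eqP; rewrite mxE psumr_eq0 => [/allP h|i _].
    apply/rowP => i; rewrite mxE; apply/eqP.
    by have := h i (mem_index_enum _); rewrite /= mxE mulf_eq0 orbb.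
  by rewrite mxE -expr2 sqr_ge0.
have min_gt0 : 0 < lambda_min M.
  (* Positive eigenvalues alone only give an infimum at least 0; finiteness of [s] gives a positive
     lower bound. The filter drops nonpositive entries of [s], and the default 1 keeps [c]
     positive. *)
  pose c := \big[Num.min/1]_(b <- s | 0 < b) b.
  have c0 : 0 < c by apply: lt_bigmin.
  apply: lt_le_trans c0 _; apply: lb_le_inf; first by exists a.
  by move=> b /= bM; apply: ge_bigmin_seq (sM _ bM) (pos _ bM).
(* The eigenvalue [a] separates the infimum from the supremum. *)
rewrite lee_fin ler_pdivlMr // mul1r; apply: (@le_trans _ _ a).
  by apply: ge_inf => //; exists 0 => b /= /pos /ltW.
apply: ub_le_sup => //; exists (\big[Num.max/0]_(b <- s) b) => b /= /sM bs.
exact: le_bigmax_seq.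
Qed.

Lemma info_matrix_sym (R : realType) q p (f : 'cV[R]_q -> 'cV[R]_p)
    n (x : 'I_n -> 'cV[R]_q) (w : 'I_n -> R) :
  (info_matrix f x w)^T = info_matrix f x w.
Proof.
rewrite /info_matrix linear_sum; apply: eq_bigr => i _.
by rewrite linearZ /= trmx_mul trmxK.
Qed.

(** Each support point contributes its weight times the square of the scalar [v *m f (x i)]. *)
Lemma info_matrix_psd (R : realType) q p (f : 'cV[R]_q -> 'cV[R]_p)
    n (x : 'I_n -> 'cV[R]_q) (w : 'I_n -> R) (v : 'rV_p) :
  (forall i, 0 <= w i) -> 0 <= (v *m info_matrix f x w *m v^T) ord0 ord0.
Proof.
move=> w0; rewrite /info_matrix mulmx_sumr mulmx_suml summxE sumr_ge0 // => i _.
rewrite -scalemxAr -scalemxAl mxE mulr_ge0 // mulmxA -(mulmxA (v *m _)) -trmx_mul.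
exact: mulmx_tr_ge0.
Qed.

Lemma cond_number_scalar (R : realType) n (a : R) :
  (0 < n)%N -> a != 0 -> cond_number (a%:M : 'M_n) = 1%:E.
Proof.
move=> n0 a0; have -> : cond_number (a%:M : 'M_n) =
    (lambda_max (a%:M : 'M_n) / lambda_min (a%:M : 'M_n))%:E.
  by rewrite /cond_number unitmxE det_scalar unitfE expf_neq0.
suff spec : spectrum (a%:M : 'M[R]_n) = [set a]%classic.
  by rewrite /lambda_max /lambda_min spec sup1 inf1 divff.
apply/seteqP; split => b /=; last first.
  (* Any nonzero vector is an eigenvector; the all-ones vector is nonzero because [n] is
     positive. *)
  move=> ->; apply/eigenvalueP; exists (const_mx 1); first exact: mul_mx_scalar.
  apply/eqP => /matrixP/(_ ord0 (Ordinal n0)); rewrite !mxE.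
  by apply/eqP/oner_neq0.
case/eigenvalueP => v; rewrite mul_mx_scalar => /eqP.
rewrite -subr_eq0 -scalerBl scaler_eq0 => /orP[|/eqP ->]; last by rewrite eqxx.
by rewrite subr_eq0 => /eqP.
Qed.

Lemma info_matrix_vertex (R : realType) q (a : R) :
  info_matrix (@scheffe1 R q) (vertex R q) (fun _ => a) = a%:M.
Proof.
(* The identity is the sum of the diagonal matrix units, and each of these is a vertex times its
   transpose. *)
rewrite -scalemx1 mx1_sum_delta scaler_sumr; apply: eq_bigr => i _.
have -> : scheffe1 (vertex R q i) = vertex R q i.
  by apply/colP => j; rewrite mxE.
by rewrite /vertex trmx_delta mul_delta_mx.
Qed.

Lemma vertex_uniform_design (R : realType) q :
  (0 < q)%N ->
  approx_design (simplex R q) (vertex R q) (fun _ : 'I_q => 1 / q%:R).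
Proof.
move=> q0; split => [i j /colP/(_ i)|i|i|].
- rewrite !mxE !eqxx andbT; case: eqP => // _ /eqP.
  by rewrite (negPf (oner_neq0 _)).
- split => [j|]; first by rewrite mxE andbT; case: eqP; rewrite ?lexx ?ler01.
  rewrite (bigD1 i) //= mxE !eqxx big1 ?addr0 // => j ji.
  by rewrite mxE (negPf ji).
- by rewrite divr_gt0 ?ltr01 ?ltr0n.
- by rewrite sumr_const card_ord -[LHS]mulr_natr divfK // pnatr_eq0 -lt0n.
Qed.

Theorem theorem3p3 (R : realType) (q : nat) (hq : (1 <= q)%N) :
  K_optimal (simplex R q) (@scheffe1 R q) (vertex R q) (fun _ : 'I_q => 1 / q%:R).
Proof.
have q0 : (1 / q%:R : R) != 0.
  by rewrite mulf_neq0 ?oner_neq0 // invr_eq0 pnatr_eq0 -lt0n.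
split; first exact: vertex_uniform_design.
  by rewrite info_matrix_vertex unitmxE det_scalar unitfE expf_neq0.
move=> m y v [_ _ v0 _] _.
rewrite info_matrix_vertex cond_number_scalar //.
apply: cond_number_ge1 => //; first exact: info_matrix_sym.
by move=> u; apply: info_matrix_psd => i; apply: ltW.
Qed.
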